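(* For any finite simple graph $G$, we have $\mathrm{cn}(G)\le \dim(\mathcal{H}(G))+1$, where $\mathrm{cn}(G)$ is the competition number of $G$ and $\mathcal{H}(G)$ is the hole space of $G$.
   Context: The competition graph of an acyclic directed graph $D$ is the undirected graph on the same vertex set as $D$ in which two distinct vertices $u,v$ are adjacent if and only if there is a vertex $w$ such that $(u,w)$ and $(v,w)$ are arcs of $D$. The competition number $\mathrm{cn}(G)$ of an undirected graph $G$ is the least number $k\ge 0$ of isolated vertices that have to be added to $G$ so that the resulting graph is the competition graph of an acyclic directed graph. A hole is an induced cycle of length at least $4$. The cycle space of $G$ is the $\mathbb{F}_2$-vector space whose vectors are those sets of edges of $G$ that form a subgraph all of whose vertices have even degree, with symmetric difference as addition. Each hole, identified with its edge set, is a vector of the cycle space. The hole space $\mathcal{H}(G)$ is the subspace of the cycle space of $G$ spanned by all holes of $G$; its dimension is taken over $\mathbb{F}_2$. All graphs are finite and simple. *)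

(* Defs.v *)
From mathcomp Require Import all_boot all_algebra.

Set Implicit Arguments.
Unset Strict Implicit.
Unset Printing Implicit Defensive.

Import GRing.Theory.

Record sgraph := SGraph {
  vertex :> finType;
  edge : rel vertex;
  edge_sym : symmetric edge;
  edge_irr : irreflexive edge
}.

Section Digraphs.

Variable V : finType.
Implicit Type D : {set V * V}.

Definition arc D : rel V := [rel u v | (u, v) \in D].

(* Quantifying over sequences of length at most #|V| loses nothing, as directed
   cycles are repetition-free; loops are directed cycles of length 1. *)
Definition acyclic D : bool :=
  [forall c : {bseq #|V| of V}, ucycleb (arc D) c ==> nilp c].

Lemma acyclicP D :
  reflect (forall c : seq V, cycle (arc D) c -> c = [::]) (acyclic D).
Proof.
apply: (iffP forallP) => [acD [//|x p] | acD c].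
  rewrite /= rcons_path => /andP[]; case/shortenP => q pq Uq _ xq.
  have sq : size (x :: q) <= #|V| by rewrite -(card_uniqP Uq) max_card.
  have := acD (Bseq sq); rewrite /ucycleb /= rcons_path pq xq.
  by move: Uq => /= ->.
by apply/implyP => /andP[/acD->].
Qed.

Definition competition_rel D : rel V :=
  [rel u v | (u != v) && [exists w, arc D u w && arc D v w]].

End Digraphs.

Section CompetitionNumber.

Variable G : sgraph.

Definition add_isolated (k : nat) : rel (G + 'I_k) :=
  fun x y => match x, y with
             | inl u, inl v => edge u v
             | _, _ => false
             end.

Definition competition_extension (k : nat) : bool :=
  [exists D : {set (G + 'I_k) * (G + 'I_k)},
     acyclic D && [forall x, forall y, add_isolated x y == competition_rel D x y]].

Lemma competition_extension_ex : exists k, competition_extension k.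
Proof.
exists #|{: G * G}|; apply/existsP.
pose D : {set (G + 'I_#|{: G * G}|) * (G + 'I_#|{: G * G}|)} :=
  [set a | match a with
           | (inl u, inr i) => let p := enum_val i in
               edge p.1 p.2 && ((u == p.1) || (u == p.2))
           | _ => false end].
exists D; apply/andP; split.
  apply/acyclicP => -[//|x [|y p]] /=; rewrite /arc /= !inE.
    by case: x.
  case: x y => [u|i] [v|j]; rewrite ?andbF //.
  by case: p => [|[z|z] p] /=; rewrite inE !andbF.
apply/forallP => x; apply/forallP => y; apply/eqP; apply/idP/idP.
  case: x y => [u|i] [v|j] //= uv; apply/andP; split.
    by apply: contraTneq uv => -[->]; rewrite edge_irr.
  apply/existsP; exists (inr (enum_rank (u, v))).
  by rewrite /arc /= !inE enum_rankK /= uv !eqxx orbT.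
case/andP=> xy /existsP[w]; rewrite /arc /= !inE.
case: x xy => [u|i] //; case: y => [v|j]; last by rewrite andbF.
move=> uv; have{} uv : u != v by apply: contraNneq uv => ->.
case: w => [w|w] //=; case: (enum_val w) => a b /=.
case/andP=> /andP[ab /orP[]/eqP eu] /andP[_ /orP[]/eqP ev];
  move: uv; rewrite eu ev ?eqxx //.
by rewrite edge_sym.
Qed.

Definition competition_number : nat := ex_minn competition_extension_ex.

End CompetitionNumber.

Section HoleSpace.

Variable G : sgraph.
Implicit Types (c : seq G) (F : {set {set G}}).

Definition edges : {set {set G}} := [set [set x; y] | x in G, y in G & edge x y].

Definition cycle_edges c : {set {set G}} := [set [set x; next c x] | x in c].

Definition hole c : bool :=
  [&& 4 <= size c, ucycleb (@edge G) c &
      [set f in edges | f \subset c] == cycle_edges c].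

Definition even_edge_set F : bool :=
  (F \subset edges) && [forall v, ~~ odd #|[set f in F | v \in f]|].

(* The set F of edges as a vector: addition of characteristic vectors over 'F_2
   is symmetric difference of sets. *)
Definition char_vec F : {ffun {set G} -> ('F_2)^o} := [ffun f => (f \in F)%:R%R].

Definition cycle_space : {vspace {ffun {set G} -> ('F_2)^o}} :=
  <<[seq char_vec F | F in even_edge_set]>>%VS.

Definition hole_space : {vspace {ffun {set G} -> ('F_2)^o}} :=
  <<[seq char_vec (cycle_edges c) |
       c : {bseq #|G| of G} in [pred c : {bseq #|G| of G} | hole c]]>>%VS.

Lemma cycle_edges_sub c : cycle (@edge G) c -> cycle_edges c \subset edges.
Proof.
move=> cyc; apply/subsetP => f /imsetP[x xc ->].
by apply/imset2P; exists x (next c x); rewrite ?inE // next_cycle.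
Qed.

Lemma hole_even c : hole c -> even_edge_set (cycle_edges c).
Proof.
case/and3P=> szc /andP[cyc Uc] _; rewrite /even_edge_set cycle_edges_sub //=.
apply/forallP => v; have [vc|vNc] := boolP (v \in c); last first.
  rewrite (_ : [set _ in _ | _] = set0) ?cards0 //; apply/setP => f.
  rewrite !inE; apply/negP => /andP[/imsetP[x xc ->]]; rewrite !inE.
  by case/orP=> /eqP ev; move: vNc; rewrite ev ?mem_next xc.
have -> : [set f in cycle_edges c | v \in f] =
          [set [set v; next c v]; [set prev c v; v]].
  apply/setP => f; rewrite !inE; apply/andP/orP => [[/imsetP[x xc ->]]|].
    rewrite !inE => /orP[]/eqP ->; first by left.
    by right; rewrite prev_next.
  case=> /eqP ->; rewrite !inE eqxx ?orbT; split=> //; apply/imsetP.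
    by exists v.
  by exists (prev c v); rewrite ?mem_prev // next_prev.
suff [n1 n2] : next c v != v /\ next c v != prev c v.
  rewrite cards2 (_ : _ != _) //; apply/eqP => /setP/(_ (next c v)).
  by rewrite !inE eqxx orbT (negPf n1) (negPf n2).
have [i s es] := rot_to vc.
rewrite -(next_rot i Uc) -(prev_rot i Uc).
move: Uc szc; rewrite -(rot_uniq i) -(size_rot i) es.
case: s {es} => [|w [|z s]] // Us _; split.
  by rewrite /= eqxx; case/and3P: Us; rewrite inE negb_or eq_sym => /andP[].
apply/eqP => /(congr1 (next [:: v, w, z & s])); rewrite next_prev //.
move: Us; rewrite /= !inE eqxx !negb_or => /and3P[/and3P[vw vz _] _ _].
  by rewrite eqxx eq_sym (negPf vw) => /eqP; rewrite eq_sym (negPf vz).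
Qed.

Lemma hole_spaceP c : hole c -> char_vec (cycle_edges c) \in hole_space.
Proof.
move=> hc; have /and3P[_ /andP[_ Uc] _] := hc.
have sc : size c <= #|G| by rewrite -(card_uniqP Uc) max_card.
apply: memv_span; apply/imageP; by exists (Bseq sc).
Qed.

Lemma hole_space_sub : (hole_space <= cycle_space)%VS.
Proof.
apply/span_subvP => _ /imageP[c hc ->]; apply: memv_span.
by apply/imageP; exists (cycle_edges c) => //; apply: hole_even.
Qed.

Lemma cycle_spaceP (x : {ffun {set G} -> ('F_2)^o}) :
  reflect (exists2 F, even_edge_set F & x = char_vec F) (x \in cycle_space).
Proof.
apply: (iffP idP) => [|[F eF ->]]; last first.
  by apply: memv_span; apply/imageP; exists F.
pose P (y : {ffun {set G} -> ('F_2)^o}) := (forall f, f \notin edges -> y f = 0%R)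
  /\ forall v : G, (\sum_(f : {set G} | v \in f) y f = 0)%R.
have f2E F : (forall v : G, (\sum_(f : {set G} | v \in f) char_vec F f)%R =
          #|[set f in F | v \in f]|%:R%R).
  move=> v; rewrite (eq_bigr (fun f => ((f \in F)%:R : ('F_2)^o)%R)); last first.
    by move=> f _; rewrite ffunE.
  rewrite -natr_sum -big_mkcondr /= sum1dep_card; congr (_%:R)%R.
  by apply: eq_card => f; rewrite !inE andbC.
have f2_0 n : ((n%:R : ('F_2)^o) == 0)%R = ~~ odd n.
  by rewrite -dvdn2 -(dvdn_pcharf (pchar_Fp (isT : prime 2))).
have PF F : P (char_vec F) <-> even_edge_set F.
  split=> [[sF dF]|/andP[sF /forallP dF]].
    apply/andP; split; last by apply/forallP=> v; rewrite -f2_0 -f2E dF.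
    apply/subsetP => f fF; apply: contraT => /sF.
    by rewrite ffunE fF => /eqP; rewrite oner_eq0.
  split=> [f fNE|v]; last by apply/eqP; rewrite f2E f2_0.
  by rewrite ffunE; case: (boolP (f \in F)) fNE => // /(subsetP sF) ->.
move=> /coord_span xE.
have Px : P x.
  rewrite xE; elim/big_ind: _ => [|y z [y1 y2] [z1 z2]|i _].
  - by split=> [f _|v]; [rewrite ffunE | rewrite big1 // => f _; rewrite ffunE].
  - split=> [f fN|v]; first by rewrite ffunE y1 // z1 // addr0.
    rewrite (eq_bigr (fun f => y f + z f)%R); last by move=> f _; rewrite ffunE.
    by rewrite big_split /= y2 z2 addr0.
  set a := coord _ _ _; set y := nth _ _ _.
  have [y1 y2] : P y.
    have /imageP[F eF ->] : y \in [seq char_vec F | F in even_edge_set].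
      by apply: mem_nth; rewrite size_tuple; apply: ltn_ord.
    by apply/PF.
  split=> [f fN|v]; first by rewrite ffunE y1 // scaler0.
  rewrite (eq_bigr (fun f => a *: y f)%R); last by move=> f _; rewrite ffunE.
  by rewrite -scaler_sumr y2 scaler0.
have xF : x = char_vec [set f | x f != 0%R].
  apply/ffunP => f; rewrite ffunE inE.
  by case: (x f) => -[|[|k]] lt //=; apply: val_inj.
by exists [set f | x f != 0%R] => //; apply/PF; rewrite -xF.
Qed.

End HoleSpace.

(* Main.v *)
From HB Require Import structures.
Require Import Defs.
From mathcomp Require Import all_boot all_algebra.

(** Vertices are eliminated one at a time. Let [U] be the set of vertices that
    are left, and suppose that the edges at [v] inside [U] are covered by [m]
    cliques. Give each of these cliques a common out-neighbour of its own,
    taken from a supply of vertices outside [U] that have not been used in this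
    way; then remove [v] from [U] and put it into the supply. Every arc goes
    from [U] to a vertex added or eliminated before, so no cycle arises. The
    step uses [m] vertices and returns one, so the supply need only have one
    vertex more than the sum of the numbers [m - 1], and this bounds the
    competition number. It remains to choose [v] so that [m - 1] is at most the
    drop in the dimension of the hole space from [U] to [U :\ v].

    The right choice is an avoidable vertex: any two nonadjacent neighbours
    [a], [b] of [v] in [U] are joined by a path whose interior is in [U] and
    avoids the closed neighbourhood of [v]. A shortest such path closes up to a
    hole through [a], [v], [b] ([avoidable_hole]). Every nonempty [U] has an
    avoidable vertex ([avoidable_exists]): if some connected [C] leaves
    vertices of [U] neither in [C] nor adjacent to it, take a largest such [C];
    if none does, [U] is a clique and any vertex will do.
    By maximality each neighbour of [C] is adjacent to every vertex of the
    remainder [W]. Hence a vertex avoidable in [W] is avoidable in [U], since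
    two of its neighbours outside [W] are joined through [C].

    For the dimension, restrict vectors of the hole space of [U] to the edges
    at [v]. The holes that miss [v] are in the kernel, so the image [S] has
    dimension at most the drop ([dim_star_space]). Call neighbours [a], [b] of
    [v] equivalent when the difference of their unit vectors is in [S].
    Nonadjacent neighbours are equivalent, because of the hole through [a],
    [v], [b]. A class has at most [\dim S + 1] elements, since the differences
    from one fixed element are independent ([card_delta_class]). So numbering
    the elements within each class partitions the neighbours into at most
    [\dim S + 1] transversals of the classes ([star_colouring]). Elements of
    different classes are adjacent, hence each transversal, together with [v],
    is a clique. The induction that assembles the digraph is
    [competition_digraph_on]. *)

Set Implicit Arguments.
Unset Strict Implicit.
Unset Printing Implicit Defensive.

Import GRing.Theory.

(** * Chordless paths and the holes they close *)

Section Avoidable.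

Variable G : sgraph.
Local Notation e := (@edge G).

(** Besides chords this forbids repetitions: no vertex of the path may equal, or
    be adjacent to, one that comes two or more places later. *)
Fixpoint chordless (x : G) (s : seq G) : bool :=
  if s is y :: s' then
    all (fun z => ~~ e x z && (x != z)) s' && chordless y s'
  else true.

(** If the first vertex equals or is adjacent to a vertex beyond the second one,
    the path can be shortened. Otherwise it suffices to treat the tail, because
    the new tail uses only vertices of the old one. *)
Lemma chordless_path x p : path e x p ->
  exists q, [/\ path e x q, last x q = last x p, {subset q <= p} &
                chordless x q].
Proof.
have [n] := ubnP (size p); elim: n x p => // n IHn x [|y p] /=.
  by exists [::].
rewrite ltnS => szp /andP[xy yp].
have [/allP far | /allPn[z zp]] :=
    boolP (all (fun z => ~~ e x z && (x != z)) p).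
  have [q [yq lq sqp cq]] := IHn y p szp yp.
  exists (y :: q); split=> //=; first by rewrite xy.
    by move=> u; rewrite !inE => /orP[-> // | /sqp ->]; rewrite orbT.
  by rewrite cq andbT; apply/allP=> u /sqp; apply: far.
case/splitPr: zp szp yp => p1 p2; rewrite cat_path size_cat last_cat /=.
move=> szp /and3P[_ _ zp2].
have shortcut p' : size p' <= (size p2).+1 -> path e x p' ->
    last x p' = last z p2 -> {subset p' <= z :: p2} ->
  exists q, [/\ path e x q, last x q = last z p2,
                {subset q <= y :: p1 ++ z :: p2} & chordless x q].
  move=> szp' xp' lp' sp'.
  have [|q [xq lq sq cq]] := IHn x p' _ xp'.
    apply: leq_ltn_trans szp' (leq_trans _ szp).
    by rewrite ltnS addnS ltnS leq_addl.
  exists q; split=> //; first by rewrite lq.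
  by move=> u /sq /sp' u2; rewrite inE mem_cat u2 !orbT.
rewrite negb_and !negbK => /orP[xz | /eqP ez].
  by apply: (shortcut (z :: p2)); rewrite //= xz.
apply: (shortcut p2); rewrite ?ez //.
by move=> u u2; rewrite inE u2 orbT.
Qed.

Lemma chordless_uniq x s : path e x s -> chordless x s -> uniq (x :: s).
Proof.
elim: s x => // y s IHs x /= /andP[xy ys] /andP[/allP far cs].
rewrite -[X in _ && X]/(uniq (y :: s)) IHs // andbT.
rewrite inE negb_or; apply/andP; split.
  by apply: contraTneq xy => ->; rewrite edge_irr.
by apply/negP => /far; rewrite eqxx andbF.
Qed.

Lemma chordless_edge x s u v : path e x s -> chordless x s ->
    u \in x :: s -> v \in x :: s -> e u v ->
  exists p1 p2, x :: s = p1 ++ [:: u, v & p2] \/ x :: s = p1 ++ [:: v, u & p2].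
Proof.
elim: s x => [|y s IHs] x /=.
  by move=> _ _; rewrite !inE => /eqP-> /eqP->; rewrite edge_irr.
move=> /andP[xy ys] /andP[/allP far cs].
have xN w : w \in y :: s -> e x w -> w = y.
  by rewrite inE => /orP[/eqP // | /far/andP[/negPf->]].
rewrite inE => /predU1P[-> | us]; rewrite inE => /predU1P[-> | vs] uv.
- by rewrite edge_irr in uv.
- by exists [::], s; left; rewrite (xN v vs uv).
- by exists [::], s; right; rewrite (xN u us) // edge_sym.
have [p1 [p2 [E|E]]] := IHs y ys cs us vs uv; rewrite E.
  by exists (x :: p1), p2; left.
by exists (x :: p1), p2; right.
Qed.

Lemma next_consecutive (c p1 p2 : seq G) u v :
  uniq c -> c = p1 ++ [:: u, v & p2] -> next c u = v.
Proof.
move=> Uc ec; rewrite -(next_rot (size p1) Uc) {1}ec rot_size_cat /=.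
by rewrite eqxx.
Qed.

Lemma mem_edges x y : ([set x; y] \in edges G) = e x y.
Proof.
apply/imset2P/idP => [[u w _] | xy]; last by exists x y; rewrite ?inE.
rewrite inE => /andP[_ uw] /setP E.
have := E x; rewrite !inE eqxx /= => /esym /orP[]/eqP ex; have := E y.
  rewrite !inE eqxx orbT ex => /esym/orP[]/eqP ey; last by rewrite ey.
  have := E w; rewrite !inE eqxx orbT ex ey orbb => /eqP ew.
  by rewrite ew edge_irr in uw.
rewrite !inE eqxx orbT ex => /esym/orP[]/eqP ey; first by rewrite ey edge_sym.
have := E u; rewrite !inE eqxx ex ey orbb /= => /eqP ew.
by rewrite ew edge_irr in uw.
Qed.

Lemma chordless_hole v a q :
    path e v (a :: q) -> e v (last a q) -> chordless a q -> 2 <= size q ->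
    v \notin a :: q ->
    (forall x, x \in a :: q -> e v x -> (x == a) || (x == last a q)) ->
  hole (v :: a :: q).
Proof.
move=> /= /andP[va aq] vb cq szq vNq Nv; set c := [:: v, a & q].
have cyc : cycle e c by rewrite /= va rcons_path aq edge_sym.
have Uc : uniq c by rewrite /= vNq; apply: chordless_uniq.
rewrite /hole -/c /ucycleb cyc Uc eqEsubset.
apply/and4P; split=> //; last first.
  apply/subsetP => f fc; rewrite inE (subsetP (cycle_edges_sub cyc)) //=.
  case/imsetP: fc => x xc ->; apply/subsetP => z.
  by case/set2P=> ->; rewrite ?mem_next.
apply/subsetP => f; rewrite inE => /andP[/imset2P[x y _]].
rewrite inE => /andP[_ xy] -> /subsetP sc.
have xc : x \in c by apply: sc; rewrite !inE eqxx.
have yc : y \in c by apply: sc; rewrite !inE eqxx orbT.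
have consec u w : u \in c -> next c u = w -> [set u; w] \in cycle_edges c.
  by move=> uc <-; apply/imsetP; exists u.
have vE w : w \in a :: q -> e v w -> [set v; w] \in cycle_edges c.
  move=> wq /(Nv w wq)/orP[]/eqP->.
    by apply: consec; rewrite ?inE ?eqxx //= eqxx.
  rewrite setUC; apply: consec; first by rewrite inE mem_last orbT.
  rewrite -(next_rotr 1 Uc) /c (lastI a q) -rcons_cons rotr1_rcons /=.
  by rewrite eqxx.
have memc w : w \in c -> w = v \/ w \in a :: q by rewrite in_cons => /predU1P.
case: (memc x xc) => [ex | xq]; case: (memc y yc) => [ey | yq].
- by rewrite ex ey edge_irr in xy.
- by rewrite ex vE // -ex.
- by rewrite ey setUC vE // -ey edge_sym.
have [p1 [p2 [E|E]]] := chordless_edge aq cq xq yq xy.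
  apply: consec => //.
  by apply: (@next_consecutive _ (v :: p1) p2); rewrite // /c E.
rewrite setUC; apply: consec => //.
by apply: (@next_consecutive _ (v :: p1) p2); rewrite // /c E.
Qed.

(** * Existence of avoidable vertices *)

(** This extends the notion of a simplicial vertex, for which the condition is
    vacuous. *)
Definition avoidable (U : {set G}) (v : G) : Prop :=
  forall a b, a \in U -> b \in U -> e v a -> e v b -> a != b -> ~~ e a b ->
  exists2 p, path e a (rcons p b) &
             {in p, forall x, [/\ x \in U, x != v & ~~ e v x]}.

(** The last property says that the hole uses exactly the edges [va] and [vb] at
    [v], which determines its restriction to the star of [v]. *)
Lemma avoidable_hole U v a b : avoidable U v -> v \in U ->
    a \in U -> b \in U -> e v a -> e v b -> a != b -> ~~ e a b ->
  exists c, [/\ hole c, {subset c <= U}, v \in c &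
                forall x, e v x -> (x \in c) = (x == a) || (x == b)].
Proof.
move=> av vU aU bU va vb ab nab.
have [p /chordless_path[q [aq lq sq cq]] pP] := av a b aU bU va vb ab nab.
rewrite last_rcons in lq.
have qP x : x \in q -> x = b \/ [/\ x \in U, x != v & ~~ e v x].
  by move/sq; rewrite mem_rcons inE => /predU1P[|/pP]; [left | right].
have ne u w : e u w -> u != w by apply: contraTneq => ->; rewrite edge_irr.
have Nv x : x \in a :: q -> e v x -> (x == a) || (x == last a q).
  rewrite lq inE => /predU1P[-> | /qP[-> | [_ _ /negPf->//]]];
  by rewrite eqxx ?orbT.
exists [:: v, a & q]; split.
- apply: chordless_hole => //=; rewrite ?va ?lq //.
    case: q aq lq cq {sq qP Nv} => [|y [|z q]] //=.
      by move=> _ E; rewrite E eqxx in ab.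
    by rewrite andbT => ay E; rewrite -E ay in nab.
  rewrite inE negb_or ne //=; apply/negP => /qP[E | [_ /eqP//]].
  by rewrite E edge_irr in vb.
- by move=> x; rewrite !inE => /or3P[/eqP-> | /eqP-> | /qP[-> | []]].
- by rewrite inE eqxx.
move=> x vx; rewrite inE eq_sym (negPf (ne _ _ vx)) /=.
apply/idP/idP => [/Nv | /orP[]/eqP->]; rewrite ?lq; first exact.
  by rewrite inE eqxx.
by rewrite -lq mem_last.
Qed.

Definition within (C : {set G}) : rel G :=
  [rel x y | [&& e x y, x \in C & y \in C]].

Definition connected (C : {set G}) : bool :=
  [forall x in C, forall y in C, connect (within C) x y].

Definition outside (U C : {set G}) : {set G} :=
  [set w in U | (w \notin C) && [forall c in C, ~~ e c w]].

Lemma connectedP C x y : connected C -> x \in C -> y \in C ->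
  exists p, [/\ path e x p, y = last x p & {subset p <= C}].
Proof.
move=> /forall_inP/(_ x)conC xC yC.
have /forall_inP/(_ y yC)/connectP[p xp ->] := conC xC.
exists p; split=> //; first by apply: sub_path xp => u w /and3P[].
elim: p x {xC conC} xp => //= z p IHp x /andP[/and3P[_ _ zC] zp] w.
by rewrite inE => /predU1P[-> // | ]; apply: IHp zp w.
Qed.

Lemma within_sym C : connect_sym (within C).
Proof.
apply: sym_connect_sym => x y.
by rewrite /within /= edge_sym [(x \in C) && _]andbC.
Qed.

Lemma connectedU1 C s c : connected C -> c \in C -> e c s -> connected (s |: C).
Proof.
move=> /forall_inP conC cC cs.
have to_s x : x \in s |: C -> connect (within (s |: C)) x s.
  case/setU1P => [-> | xC]; first exact: connect0.
  apply: (@connect_trans _ _ c); last first.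
    by apply: connect1; rewrite /within /= cs !inE cC eqxx orbT.
  have /forall_inP/(_ c cC) := conC x xC.
  apply: connect_sub => u w /and3P[uw uC wC].
  by apply: connect1; rewrite /within /= uw !inE uC wC !orbT.
apply/forall_inP => x xC; apply/forall_inP => y yC.
by apply: connect_trans (to_s x xC) _; rewrite within_sym to_s.
Qed.

(** Induction on the size of [U]. When no connected set leaves a vertex outside
    its closed neighbourhood, [U] is a clique, as the singletons show. *)
Lemma avoidable_exists U : U != set0 -> exists2 v, v \in U & avoidable U v.
Proof.
have [n] := ubnP #|U|; elim: n U => // n IHn U; rewrite ltnS => leUn U0.
pose good (C : {set G}) :=
  [&& C \subset U, C != set0, connected C & outside U C != set0].
have [C0 goodC0 | none] := pickP good; last first.
  have [v vU] := set0Pn _ U0; exists v => // a b aU bU va vb ab nab.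
  have /and4P[] := negbT (none [set a]); split.
  - by rewrite sub1set.
  - by apply/set0Pn; exists a; rewrite inE.
  - apply/forall_inP => x /set1P->; apply/forall_inP => y /set1P->.
    exact: connect0.
  apply/set0Pn; exists b; rewrite !inE bU eq_sym ab /=.
  by apply/forall_inP => c /set1P->.
have [C /and4P[sCU C_neq0 conC W_neq0] maxC] :=
  arg_maxnP (fun C : {set G} => #|C|) goodC0.
set W := outside U C in W_neq0.
have WP w : w \in W -> [/\ w \in U, w \notin C & {in C, forall c, ~~ e c w}].
  by rewrite inE => /and3P[wU wC /forall_inP]; split.
have sWU : W \subset U by apply/subsetP => w /WP[].
have [w wW avw] : exists2 v, v \in W & avoidable W v.
  apply: IHn W_neq0; apply: leq_trans leUn; apply: proper_card.
  rewrite properE sWU; have [c cC] := set0Pn _ C_neq0.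
  apply/subsetPn; exists c; first exact: (subsetP sCU).
  by apply/negP => /WP[_ /negP].
have [wU wNC Cw] := WP w wW.
(* If s missed some vertex of W, then s |: C would be a larger good set. *)
have SW s c : s \in U -> c \in C -> e c s -> s \notin C ->
    {in W, forall w, e s w}.
  move=> sU cC cs sNC x xW; have [xU xNC Cx] := WP x xW.
  apply: contraT => nsx; have /maxC/= : good (s |: C).
    apply/and4P; split; first by rewrite subUset sub1set sU.
    - by apply/set0Pn; exists s; rewrite !inE eqxx.
    - exact: connectedU1 cC cs.
    apply/set0Pn; exists x; rewrite !inE xU negb_or xNC andbT /=.
    apply/andP; split; first by apply: contraTneq cs => <-; apply: Cx.
    by apply/forall_inP => y /setU1P[-> // | ]; apply: Cx.
  by rewrite cardsU1 sNC ltnn.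
have split_nbr x : x \in U -> e w x ->
    x \in W \/ (exists2 c, c \in C & e c x) /\ x \notin C.
  move=> xU wx; have xNC : x \notin C.
    by apply: contraTN wx => /Cw; rewrite edge_sym.
  have [xW | xNW] := boolP (x \in W); [by left | right; split=> //].
  move: xNW; rewrite /W inE xU xNC /= negb_forall_in => /exists_inP[c cC].
  by rewrite negbK; exists c.
exists w => // a b aU bU wa wb ab nab.
case: (split_nbr a aU wa) => [aW | [[c cC ca] aNC]];
  case: (split_nbr b bU wb) => [bW | [[d dC db] bNC]].
(* A pair with just one member in W is adjacent by SW, and a pair outside W is
   joined through C. *)
- have [p ap pP] := avw a b aW bW wa wb ab nab.
  by exists p => // x /pP[xW xw wx]; split=> //; apply: (subsetP sWU).
- by rewrite edge_sym (SW b d) in nab.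
- by rewrite (SW a c) in nab.
have [p [cp lp sp]] := connectedP conC cC dC.
exists (c :: p) => [|x xp].
  by rewrite /= edge_sym ca rcons_path cp -lp.
have xC : x \in C by move: xp; rewrite inE => /predU1P[-> | /sp].
split; first exact: (subsetP sCU).
  by apply: contraNneq wNC => <-.
by rewrite edge_sym Cw.
Qed.

End Avoidable.

(** * The hole space at an avoidable vertex *)

(** The colour of a vertex is its position in an enumeration of its class. *)
Lemma transversal_colouring (T : finType) (N : {set T}) (R : rel T) m :
    equivalence_rel R -> {in N, forall a, #|[set b in N | R a b]| <= m} ->
  exists2 col : T -> nat, {in N, forall a, col a < m} &
    {in N &, forall a b, R a b -> col a = col b -> a = b}.
Proof.
move=> eqR leNm; pose cls a := [set b in N | R a b].
have cls_id a : a \in N -> a \in enum (cls a).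
  by move=> aN; rewrite mem_enum inE aN; have [] := eqR a a a.
exists (fun a => index a (enum (cls a))) => [a aN | a b aN bN Rab].
  by apply: leq_trans (leNm a aN); rewrite cardE index_mem cls_id.
have -> : cls a = cls b.
  by apply/setP=> c; rewrite !inE; have [_ ->] := eqR a b c.
move=> eq_ab; rewrite -(nth_index a (cls_id b bN)) -eq_ab nth_index //.
by rewrite mem_enum inE aN; have [Raa /(_ Rab) <-] := eqR a b a.
Qed.

Section HoleDimension.

Variable G : sgraph.
Implicit Type U : {set G}.
Local Notation e := (@edge G).
Local Open Scope ring_scope.
Local Notation edge_vector := {ffun {set G} -> ('F_2)^o}.
Local Notation vertex_vector := {ffun G -> ('F_2)^o}.

Definition hole_space_on (U : {set G}) : {vspace edge_vector} :=
  <<[seq char_vec (cycle_edges c) | c : {bseq #|G| of G}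
     in [pred c : {bseq #|G| of G} | hole c & all [in U] c]]>>%VS.

Lemma mem_hole_space_on U c :
  hole c -> {subset c <= U} -> char_vec (cycle_edges c) \in hole_space_on U.
Proof.
move=> hc /allP cU; have /and3P[_ /andP[_ Uc] _] := hc.
have sc : (size c <= #|G|)%N by rewrite -(card_uniqP Uc) max_card.
by apply: memv_span; apply/imageP; exists (Bseq sc); rewrite // inE hc.
Qed.

Lemma hole_space_on_ind U (W : {vspace edge_vector}) :
    (forall c, hole c -> {subset c <= U} -> char_vec (cycle_edges c) \in W) ->
  (hole_space_on U <= W)%VS.
Proof.
move=> holeW; apply/span_subvP => _ /imageP[c /andP[hc /allP cU] ->].
exact: holeW.
Qed.

(** The entry at [v] itself belongs to the singleton [[set v; v]], which is not
    an edge, so it vanishes on every hole. *)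
Definition star (v : G) (x : edge_vector) : vertex_vector :=
  [ffun a => x [set v; a]].

Fact star_is_linear v : linear (star v).
Proof. by move=> k x y; apply/ffunP => a; rewrite !ffunE. Qed.

HB.instance Definition _ v :=
  GRing.isLinear.Build _ edge_vector vertex_vector _ (star v)
    (star_is_linear v).

Definition delta (a : G) : vertex_vector := [ffun x => (x == a)%:R].

Lemma delta_free s : uniq s -> free [seq delta a | a <- s].
Proof.
elim: s => [|a s IHs] /=; first by rewrite nil_free.
case/andP=> aNs Us; rewrite free_cons IHs // andbT; apply/negP.
move/(@coord_span _ _ _ (in_tuple (map delta s)))/ffunP/(_ a).
rewrite ffunE eqxx sum_ffunE big1 => [/eqP|i _].
  by rewrite oner_eq0.
rewrite ffunE; have := mem_tnth i (in_tuple (map delta s)).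
rewrite (tnth_nth 0) => /mapP[b bs ->]; rewrite ffunE.
by rewrite (_ : (a == b) = false) ?scaler0 //; apply: contraNF aNs => /eqP->.
Qed.

Definition star_space U v := (linfun (star v) @: hole_space_on U)%VS.

(** Holes that avoid [v] have no edge at [v], so they are in the kernel of the
    restriction to the star of [v]. *)
Lemma dim_star_space U v :
  (\dim (hole_space_on (U :\ v)) + \dim (star_space U v)
    <= \dim (hole_space_on U))%N.
Proof.
rewrite -(limg_ker_dim (linfun (star v)) (hole_space_on U)) leq_add2r.
apply: dimvS; apply: hole_space_on_ind => c hc cU; rewrite memv_cap.
rewrite mem_hole_space_on //=; last by move=> x /cU/setD1P[].
rewrite memv_ker lfunE /=; apply/eqP/ffunP => a; rewrite !ffunE.
case: imsetP => // -[x xc E].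
have /setD1P[] : v \in U :\ v.
  apply: cU; have : v \in [set v; a] by rewrite !inE eqxx.
  by rewrite E => /set2P[]->; rewrite ?mem_next.
by rewrite eqxx.
Qed.

(** The difference is the restriction of a hole through [a], [v], [b], as signs
    are immaterial in characteristic 2. *)
Lemma star_space_delta U v a b : avoidable U v -> v \in U ->
    a \in U -> b \in U -> e v a -> e v b -> a != b -> ~~ e a b ->
  delta a - delta b \in star_space U v.
Proof.
move=> av vU aU bU va vb ab nab.
have [c [hc cU vc cE]] := avoidable_hole av vU aU bU va vb ab nab.
suff -> : delta a - delta b = linfun (star v) (char_vec (cycle_edges c)).
  by rewrite memv_img // mem_hole_space_on.
have /and3P[_ _ /eqP ec] := hc.
rewrite lfunE /=; apply/ffunP => x; rewrite !ffunE -ec inE mem_edges.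
rewrite (_ : _ && _ = (x == a) || (x == b)).
  have [->|] := eqVneq x a; first by rewrite (negPf ab) subr0.
  (* At x = b the equation is -1 = 1 in 'F_2. *)
  by case: (x == b) => _; rewrite ?subr0 //; apply/eqP.
have [vx | nvx] := boolP (e v x).
  rewrite -cE //=; apply/subsetP/idP => [-> // | xc z]; first by rewrite set22.
  by case/set2P=> ->.
by symmetry; apply/negP => /orP[]/eqP E; rewrite E ?va ?vb in nvx.
Qed.

(** The unit vectors of the members of [A] are independent, and all of them lie
    in the sum of [W] and the line through [delta a]. *)
Lemma card_delta_class (W : {vspace vertex_vector}) a (A : {set G}) :
  {in A, forall b, delta a - delta b \in W} -> (#|A| <= (\dim W).+1)%N.
Proof.
move=> AW; have /eqP := delta_free (enum_uniq A).
rewrite size_map -cardE => <-; rewrite -[X in (_ <= X)%N]addn1.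
apply: (@leq_trans (\dim (W + <[delta a]>)%VS)).
  apply: dimvS; apply/span_subvP => _ /mapP[b bA ->].
  rewrite -[delta b](subKr (delta a)) addrC memv_add ?memv_line //.
    by rewrite memvN AW // -mem_enum.
apply: leq_trans (dimv_add_leqif _ _) _; rewrite leq_add2l dim_vline.
by case: eqP.
Qed.

(** Two neighbours whose unit vectors are not congruent modulo the star space
    are adjacent, by [star_space_delta], so a transversal of the congruence
    classes is a clique. *)
Lemma star_colouring U v : avoidable U v -> v \in U ->
  exists2 col : G -> nat,
    {in U, forall a, e v a -> col a <= \dim (star_space U v)}%N &
    {in U &, forall a b, e v a -> e v b -> a != b -> col a = col b -> e a b}.
Proof.
move=> av vU; set W := star_space U v.
have eqR : equivalence_rel (fun a b => delta a - delta b \in W).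
  move=> a b c; rewrite subrr mem0v; split=> // ab.
  by rewrite -[RHS](rpredDl _ ab) addrA subrK.
have [a _ | col ltcol inj] :=
  @transversal_colouring _ [set a in U | e v a] _ (\dim W).+1 eqR.
  by apply: (@card_delta_class _ a) => b; rewrite inE => /andP[].
exists col => [c cU vc | b c bU cU vb vc bc eq_col].
  by rewrite -ltnS ltcol // inE cU.
apply: contraT => nbc; have /eqP[] := bc.
by apply: inj; rewrite ?inE ?bU ?cU //; apply: star_space_delta.
Qed.

End HoleDimension.

(** * Assembling the acyclic digraph *)

Lemma rank_acyclic (V : finType) (D : {set V * V}) (r : V -> nat) :
  {in D, forall a, r a.2 < r a.1} -> acyclic D.
Proof.
move=> lt_r; apply/acyclicP => -[//|x c] /= xc.
have gtn_trans : transitive (fun x y => r y < r x).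
  by move=> y u z yu zy; apply: ltn_trans zy yu.
have : sorted (fun x y => r y < r x) (x :: rcons c x).
  by apply: sub_path xc => u w uw; apply: (lt_r (u, w)).
move=> /(order_path_min gtn_trans)/allP/(_ x).
by rewrite mem_rcons mem_head ltnn => /(_ isT).
Qed.

(** [T] is the supply of vertices that may still serve as common out-neighbours.
    The rank [r] witnesses acyclicity, and the conditions on sources and targets
    keep the cliques of different elimination steps from sharing a target. *)
Lemma competition_digraph_on (G : sgraph) k (U : {set G}) (T : {set G + 'I_k}) :
    {in U, forall u, inl u \notin T} -> \dim (hole_space_on U) < #|T| ->
  exists (D : {set (G + 'I_k) * (G + 'I_k)}) (r : G + 'I_k -> nat),
  [/\ {in D, forall a, exists2 u, u \in U & a.1 = inl u},
      {in D, forall a, a.2 \in T \/ exists2 u, u \in U & a.2 = inl u},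
      {in D, forall a, r a.2 < r a.1} &
      forall x y, competition_rel D x y =
        match x, y with
        | inl u, inl v => [&& edge u v, u \in U & v \in U]
        | _, _ => false
        end].
Proof.
have [n] := ubnP #|U|; elim: n U T => // n IHn U T.
rewrite ltnS => leUn TU dimT.
have [-> | U_neq0] := eqVneq U set0.
  exists set0, (fun=> 0); split=> [a|a|a|x y]; rewrite ?in_set0 //.
  have -> : competition_rel set0 x y = false.
    by apply/negP=> /andP[_ /existsP[w]]; rewrite /Defs.arc /= in_set0.
  by case: x y => [u|i] [v|j]; rewrite ?in_set0 ?andbF.
have [v vU av] := avoidable_exists U_neq0.
have [col lecol colP] := star_colouring av vU.
have ne u w : @edge G u w -> u != w.
  by apply: contraTneq => ->; rewrite edge_irr.
pose t a := nth (inl v) (enum T) (col a).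
have lt_t a : a \in U -> edge v a -> col a < size (enum T).
  move=> aU va; rewrite -cardE; apply: leq_ltn_trans (lecol a aU va) _.
  apply: leq_ltn_trans dimT; apply: leq_trans (dim_star_space U v).
  exact: leq_addl.
have tT a : a \in U -> edge v a -> t a \in T.
  by move=> aU va; rewrite -mem_enum mem_nth // lt_t.
pose N := [set a in U | edge v a]; pose M := [set t a | a in N].
have sMT : M \subset T.
  by apply/subsetP => _ /imsetP[a /setIdP[aU va] ->]; apply: tT.
have leM : #|M| <= (\dim (star_space U v)).+1.
  set m := _.+1; pose M' := [set nth (inl v) (enum T) i | i : 'I_m].
  apply: (@leq_trans #|M'|); last first.
    by rewrite -[X in _ <= X]card_ord leq_imset_card.
  apply/subset_leq_card/subsetP => _ /imsetP[a /setIdP[aU va] ->].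
  by apply/imsetP; exists (Ordinal (lecol a aU va : col a < m)).
(* The targets just used leave the supply, and v joins it. *)
pose U' := U :\ v; pose T' := inl v |: (T :\: M).
have [||| D' [r' [D'U D'T D'r D'C]]] := IHn U' T'.
- by apply: leq_trans leUn; rewrite [X in _ <= X](cardsD1 v) vU.
- move=> u /setD1P[uv uU]; rewrite !inE negb_or negb_and (TU u uU) orbT andbT.
  by apply: contraNneq uv => -[->].
- rewrite cardsU1 inE negb_and (TU v vU) orbT cardsD (setIidPr sMT) add1n ltnS.
  rewrite leq_subRL ?subset_leq_card //; apply: leq_trans dimT.
  apply: leq_trans (leq_add leM (leqnn _)) _; rewrite addSn ltnS addnC.
  exact: dim_star_space.
(* The vertex v belongs to every clique used at this step. *)
pose D := D' :|: [set (inl a, t a) | a in N] :|: [set (inl v, t a) | a in N].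
have DP x w : (x, w) \in D -> (x, w) \in D' \/
    exists a, [/\ a \in N, w = t a & x = inl a \/ x = inl v].
  by case/setUP=> [/setUP[|] | ]; [left | |] => // /imsetP[a aN [-> ->]];
    right; exists a; split; auto.
have NP a : a \in N -> [/\ a \in U, edge v a & t a \in T].
  by case/setIdP=> aU va; rewrite tT.
have D'M x w : (x, w) \in D' -> w \notin M.
  move=> xw; apply: contraT; rewrite negbK => wM.
  have wT := subsetP sMT w wM.
  case: (D'T _ xw) => /= [/setU1P[ew | ] | [u /setD1P[_ uU] ew]].
  - by rewrite ew (negPf (TU v vU)) in wT.
  - by rewrite inE wM.
  - by rewrite ew (negPf (TU u uU)) in wT.
(* The old ranks on U' move up by two, to leave 1 for v, which is a target of
   old arcs and a source of new ones, and 0 for the supply. *)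
pose r (x : G + 'I_k) :=
  if x is inl u then if u \in U' then (r' x).+2 else (u == v : nat) else 0.
have rT w : w \in T -> r w = 0.
  case: w => //= u uT; rewrite !inE andbC.
  have uNU : u \notin U by apply: contraTN uT => /TU.
  by rewrite (negPf uNU); case: eqP uNU => // ->; rewrite vU.
have r_gt0 u : u \in U -> 0 < r (inl u).
  by move=> uU; rewrite /r !inE uU andbT; case: eqP.
exists D, r; split.
- move=> [x w] /DP[/D'U/= [u /setD1P[_ uU] ->] | [a [/NP[aU _ _] _]]] /=.
    by exists u.
  by case=> ->; [exists a | exists v].
- move=> [x w] /DP[/D'T/= [|] | ] /=;
    [case/setU1P=> [->|/setDP[wT _]] | case=> u /setD1P[_ uU] -> | ].
  + by right; exists v.
  + by left.
  + by right; exists u.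
  by case=> a [/NP[_ _ taT] -> _]; left.
- move=> [x w] /DP[xw | [a [/NP[aU _ taT] -> ex]]] /=; last first.
    by rewrite rT //; case: ex => ->; apply: r_gt0.
  have /= [u uU' ex] := D'U _ xw; have /= := D'r _ xw.
  rewrite ex [r (inl u)]/r uU' => lt_r'.
  case: (D'T _ xw) => /= [/setU1P[->|/setDP[wT _]] | [z zU' ez]].
  + by rewrite /r !inE eqxx.
  + by rewrite rT.
  by rewrite ez /r zU' !ltnS -ez.
have D_sub x w : (x, w) \in D' -> (x, w) \in D by move=> xw; rewrite !inE xw.
have Da a : a \in N -> (inl a, t a) \in D.
  by move=> aN; apply/setUP; left; apply/setUP; right; apply: imset_f.
have Dv a : a \in N -> (inl v, t a) \in D.
  by move=> aN; apply/setUP; right; apply: (imset_f (fun a => (inl v, t a))).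
have tM a : a \in N -> t a \in M by apply: imset_f.
have D'CD x y : competition_rel D' x y -> competition_rel D x y.
  case/andP=> xy /existsP[w /andP[xw yw]]; apply/andP; split=> //.
  apply/existsP.
  by exists w; rewrite /Defs.arc /= !D_sub.
move=> x y; apply/idP/idP; last first.
  case: x y => [u|i] [w|j] // /and3P[uw uU wU].
  have [eu|uv] := eqVneq u v.
    have wN : w \in N by rewrite inE wU -eu.
    apply/andP; split; first by apply: contraNneq (ne _ _ uw) => -[->].
    by apply/existsP; exists (t w); rewrite /Defs.arc /= eu Dv ?Da.
  have [ew|wv] := eqVneq w v.
    have uN : u \in N by rewrite inE uU -ew edge_sym.
    apply/andP; split; first by apply: contraNneq (ne _ _ uw) => -[->].
    by apply/existsP; exists (t u); rewrite /Defs.arc /= ew Dv ?Da.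
  by apply: D'CD; rewrite D'C uw !inE uv wv uU.
case/andP=> xy /existsP[w /andP[/DP xw /DP yw]].
case: xw yw => [xw | [a [aN ew ex]]] [yw | [b [bN ew' ey]]].
- have : competition_rel D' x y.
    by apply/andP; split=> //; apply/existsP; exists w; rewrite /Defs.arc /= xw.
  rewrite D'C; case: x y {xy xw yw} => [u|i] [z|j] //.
  by case/and3P=> -> /setD1P[_ ->] /setD1P[_ ->].
- by have := D'M _ _ xw; rewrite ew' tM.
- by have := D'M _ _ yw; rewrite ew tM.
have [[aU va _] [bU vb _]] := (NP a aN, NP b bN).
case: ex ey xy => -> [] -> xy.
- rewrite aU bU !andbT; apply: colP => //.
  apply/eqP; rewrite -(nth_uniq (inl v) (lt_t a aU va) (lt_t b bU vb)).
    by rewrite -/(t a) -/(t b) -ew -ew'.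
  exact: enum_uniq.
- by rewrite edge_sym va aU vU.
- by rewrite vb bU vU.
by rewrite eqxx in xy.
Qed.

Theorem theorem24 (G : sgraph) :
  competition_number G <= \dim (hole_space G) + 1.
Proof.
set k := _ + 1.
have dimT : \dim (@hole_space_on G setT) < #|[set @inr G 'I_k i | i in 'I_k]|.
  rewrite card_imset; last by move=> i j [].
  rewrite card_ord /k addn1 ltnS; apply: dimvS.
  by apply: hole_space_on_ind => c hc _; apply: hole_spaceP.
have [|D [r [_ _ Dr DC]]] := competition_digraph_on _ dimT.
  by move=> u _; apply/imsetP => -[].
rewrite /competition_number; case: ex_minnP => m _; apply.
apply/existsP; exists D; rewrite (rank_acyclic Dr) /=.
apply/forallP => x; apply/forallP => y; rewrite DC.
by case: x y => [u|i] [v|j]; rewrite ?inE ?andbT.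
Qed.
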